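(* For every tree in $\mathcal{F}^{(n\ldots 1)}$, its Goulden-Yong Dual is the same labeled graph as its dual.
   Context: $\mathbf{S}_n$ is the symmetric group on $[n]=\{1,\ldots,n\}$; permutations are multiplied from left to right (in $p\cdot q$, $p$ is applied first). A transposition sequence over $\mathbf{S}_n$ is a finite sequence $\langle s_1,\ldots,s_m\rangle$ of transpositions, with product $s_1\cdots s_m$; it is identified with the labeled graph on vertex set $[n]$ having, for each $s_i=(x_i,y_i)$, an edge labeled $i$ between $x_i$ and $y_i$. $\mathcal{F}^{(n\ldots 1)}$ is the set of length $n-1$ transposition sequences over $\mathbf{S}_n$ whose product is the cycle $(n,\ldots,2,1)$ (mapping $n\mapsto n-1\mapsto\cdots\mapsto 1\mapsto n$); their graphs are trees (Dénes). Dual (Trail Dual, which equals the Mind-Body Dual): in a labeled graph $G$ (vertices labeled by $[n]$, edges labeled bijectively by $[m]$), for a vertex $u$ the Minimal Increasing Greedy Trail $T_u$ is the trail (no repeated edges) starting at $u$ that at each step takes, among the edges incident to the current vertex whose labels are larger than those of all previously used edges, the one with the smallest label, and stops when there is no such edge. Each edge is used by exactly two of these trails. The dual of $G$ is the labeled graph on the same vertex set in which, for each label $k$, there is an edge labeled $k$ between the two vertices $x,y$ such that $T_x$ and $T_y$ both use the edge of $G$ labeled $k$. Circle Chord Diagram of a labeled tree on $n$ vertices: a circle with $n$ distinct points on it labeled $1,\ldots,n$ in clockwise order, with a chord between $x$ and $y$, carrying the edge label, for each edge $\{x,y\}$ of the tree. For a tree in $\mathcal{F}^{(n\ldots 1)}$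 the chords are non-crossing, i.e. any two meet at most at a point on the circle (Goulden–Yong). The $n$ points divide the circle into $n$ arcs: for $2\le k\le n$, arc $k$ is the arc between $k-1$ and $k$, and arc $1$ is the arc between $n$ and $1$. The chords divide the disk into $n$ regions, each containing exactly one of the arcs; the region containing arc $k$ is region $k$. Goulden-Yong Dual of a tree in $\mathcal{F}^{(n\ldots 1)}$: the labeled graph with one vertex for each region of its Circle Chord Diagram, the vertex of region $k$ being labeled $k$, and with an edge between two vertices whenever their regions have a chord in common on their boundaries, that edge getting the label of the chord. *)

(* Defs.v *)
(* [n] is the type 'I_n and edge labels range over 'I_m, so vertices, edge
   labels and arcs are numbered from 0. *)
From HB Require Import structures.
From mathcomp Require Import all_boot all_order all_algebra all_fingroup.
From mathcomp Require Import all_classical all_reals all_analysis.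

Set Implicit Arguments.
Unset Strict Implicit.
Unset Printing Implicit Defensive.

Import Order.TTheory GRing.Theory Num.Theory.
Import numFieldNormedType.Exports.

Local Open Scope classical_set_scope.
Local Open Scope ring_scope.

Record labeled_graph (n m : nat) := LabeledGraph {
  vertex : Type;
  has_label : vertex -> 'I_n -> Prop;
  edge : 'I_m -> vertex -> vertex -> Prop
    (* edge k x y: there is an edge labeled k between x and y *)
}.

Definition same_labeled_graph (n m : nat) (G H : labeled_graph n m) : Prop :=
  exists f : vertex G -> vertex H,
    [/\ bijective f,
        forall x i, has_label x i <-> has_label (f x) i
      & forall k x y, edge k x y <-> edge k (f x) (f y)].

Definition is_transposition (n : nat) (p : {perm 'I_n}) : Prop :=
  exists x y : 'I_n, x != y /\ p = tperm x y.

(* The cycle (n, ..., 2, 1): on 'I_n, ord_pred is i |-> i - 1 mod n. *)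
Definition descending_cycle (n : nat) : {perm 'I_n} := perm (@ord_pred_inj n).

(* In MathComp, (p * q)%g applies p first. *)
Definition descending_factorization (n : nat)
    (s : (n.-1).-tuple {perm 'I_n}) : Prop :=
  (forall k, is_transposition (tnth s k)) /\
  (\prod_(p <- s) p)%g = descending_cycle n.

Definition graph_of_seq (n m : nat) (s : m.-tuple {perm 'I_n}) :
    labeled_graph n m :=
  @LabeledGraph n m 'I_n (fun x i => x = i)
    (fun k x y => x <> y /\ tnth s k = tperm x y).

Section TrailDual.
Variables (n m : nat) (G : labeled_graph n m).

Definition available (used : seq 'I_m) (x : vertex G) (k : 'I_m) : Prop :=
  (exists y, edge k x y) /\ (forall j, j \in used -> (j < k)%N).

(* greedy_trail used x t: standing at x after using the edges labeled by used,
   the minimal increasing greedy trail continues with the edge labels t. *)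
Inductive greedy_trail : seq 'I_m -> vertex G -> seq 'I_m -> Prop :=
| greedy_stop used x :
    (forall k, ~ available used x k) -> greedy_trail used x [::]
| greedy_step used x k y t :
    available used x k ->
    (forall j, available used x j -> (k <= j)%N) ->
    edge k x y ->
    greedy_trail (rcons used k) y t ->
    greedy_trail used x (k :: t).

Definition trail_uses (u : vertex G) (k : 'I_m) : Prop :=
  exists t, greedy_trail [::] u t /\ k \in t.

Definition trail_dual : labeled_graph n m :=
  @LabeledGraph n m (vertex G) (@has_label n m G)
    (fun k x y => [/\ x <> y, trail_uses x k & trail_uses y k]).

End TrailDual.

(* A circle in the plane with n distinct points in clockwise order, given by
   their angles: clockwise means that the angles decrease, and all n points are
   passed within less than one turn. *)
Record clockwise_points (R : realType) (n : nat) := ClockwisePoints {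
  center : R * R;
  radius : R;
  radius_gt0 : 0 < radius;
  angle : 'I_n -> R;
  angle_decreasing : forall i j : 'I_n, (i < j)%N -> angle j < angle i;
  angle_one_turn : forall i j : 'I_n, angle i < angle j + 2 * pi
}.

Section CircleChordDiagram.
Variables (R : realType) (n m : nat).
Variables (D : clockwise_points R n) (G : labeled_graph n m).

Definition circle_point (a : R) : R * R :=
  ((center D).1 + radius D * cos a, (center D).2 + radius D * sin a).

Definition disk : set (R * R) :=
  [set z | (z.1 - (center D).1) ^+ 2 + (z.2 - (center D).2) ^+ 2
           <= radius D ^+ 2].

Definition segment (p q : R * R) : set (R * R) :=
  [set (line_path p.1 q.1 t, line_path p.2 q.2 t) | t in `[0, 1]].

Definition chord (k : 'I_m) : set (R * R) :=
  [set z | exists (x y : vertex G) (i j : 'I_n),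
     [/\ edge k x y, has_label x i, has_label y j
       & segment (circle_point (angle D i)) (circle_point (angle D j)) z]].

(* The open arc swept clockwise from the point before i to the point i; the
   arc of index 0 goes from the last point to point 0, whose angle is then
   taken one turn further. *)
Definition arc (i : 'I_n) : set (R * R) :=
  [set circle_point a | a in
     [set a | (if i == 0%N :> nat then angle D i - 2 * pi else angle D i)
                < a < angle D (ord_pred i)]].

Definition disk_minus_chords : set (R * R) :=
  disk `\` \bigcup_(k in [set: 'I_m]) chord k.

Definition is_region (A : set (R * R)) : Prop :=
  exists2 z, disk_minus_chords z & A = connected_component disk_minus_chords z.

Definition boundary (A : set (R * R)) : set (R * R) := closure A `\` interior A.

Definition goulden_yong_dual : labeled_graph n m :=
  @LabeledGraph n m {A : set (R * R) | is_region A}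
    (fun A i => arc i `<=` sval A)
    (fun k A B => [/\ sval A <> sval B, chord k `<=` boundary (sval A)
                    & chord k `<=` boundary (sval B)]).

End CircleChordDiagram.

(* Main.v *)
(* Write s = P ++ (a b) :: Q with a < b. Conjugating Q by (a b), the cycle
   (n ... 1) followed by (a b), whose two cycles are (a, b] and its complement,
   is a product of n - 2 transpositions. These leave some 2-coloring invariant,
   so all of them preserve both cycles. Hence the factors in P preserve (a, b],
   those in Q preserve [a, b), and the trail of u, which runs through the images
   of u under the prefix products, never leaves the closed side of the chord
   (a, b) that contains arc u.
   A region of the disk minus the chords is the set of points with a prescribed
   side of each chord: such a set is convex, and the sides are locally constant.
   The region of arc i has chord k on its boundary iff the ends of chord k lie on
   the closed sides of arc i, and this happens iff the trail of i uses edge k;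
   the two arcs whose trails use k lie on opposite sides of chord k. *)

From Pilot Require Import Defs.
From mathcomp Require Import all_boot all_order all_algebra all_fingroup.
From mathcomp Require Import all_classical all_reals all_analysis.
From mathcomp Require Import zify ring lra.

Set Implicit Arguments.
Unset Strict Implicit.
Unset Printing Implicit Defensive.

Import Order.TTheory GRing.Theory Num.Theory.
Import numFieldNormedType.Exports.
(* Restores [center] and [arc], shadowed by MathComp. *)
Import Pilot.Defs.

(** * Short factorizations of the long cycle and the intervals their factors preserve *)

Section TranspositionFactorizations.
Local Open Scope nat_scope.

Lemma tperm_neqP n (a b z : 'I_n) :
  a != b -> reflect (z = a \/ z = b) (tperm a b z != z).
Proof.
move=> ab; apply: (iffP idP); last by case=> ->; rewrite ?tpermL ?tpermR // eq_sym.
by case: tpermP => [-> _|-> _|_ _ /eqP//]; [left|right].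
Qed.

(* Each transposition merges at most two colors. *)
Lemma invariant_coloring n (L : seq {perm 'I_n}) :
  (forall p, p \in L -> is_transposition p) ->
  exists f : 'I_n -> 'I_n,
    (forall p z, p \in L -> f (p z) = f z) /\
    n <= #|[set f z | z : 'I_n]| + size L.
Proof.
elim: L => [_|p L IH Ltr].
  exists id; split=> //; rewrite addn0 (_ : [set _ | _ in _] = [set: _]%SET) ?cardsT ?card_ord //.
  by apply/setP => z; rewrite inE; apply/imsetP; exists z.
have [|f [fL nf]] := IH; first by move=> q qL; apply: Ltr; rewrite inE qL orbT.
have [x [y [_ pE]]] := Ltr p (mem_head _ _).
exists (fun z => if f z == f x then f y else f z); split=> [q z|].
  rewrite inE => /orP[/eqP -> {q}|qL]; last by rewrite fL.
  rewrite pE; case: tpermP => [->|->|//]; rewrite eqxx //; by case: ifP.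
apply: (leq_trans nf); rewrite /= addnS -addSn leq_add2r (cardsD1 (f x)).
apply: (@leq_trans (1 + #|[set f z | z : 'I_n] :\ f x|)); first by case: (_ \in _).
rewrite add1n ltnS; apply/subset_leq_card/fintype.subsetP => w; rewrite 2!inE.
case/andP=> wx /imsetP[z _ wE]; apply/imsetP; exists z => //.
by rewrite -wE (negPf wx).
Qed.

Lemma prod_invariant n (T : Type) (f : 'I_n -> T) (L : seq {perm 'I_n}) :
  (forall p z, p \in L -> f (p z) = f z) ->
  forall z, f ((\prod_(p <- L) p)%g z) = f z.
Proof.
elim: L => [_ z|p L IH fL z]; first by rewrite big_nil perm1.
rewrite big_cons permM IH; first by rewrite fL ?mem_head.
by move=> q w qL; apply: fL; rewrite inE qL orbT.
Qed.

(* The cycle (n ... 1) followed by (a b) has the two cycles (a, b] and its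
   complement. *)
Lemma split_cycle_coloring n (T : Type) (f : 'I_n -> T) (a b : 'I_n) : a < b ->
  (forall z, f (tperm a b (ord_pred z)) = f z) ->
  forall z : 'I_n, f z = if a < z <= b then f b else f a.
Proof.
case: n f a b => [|n] f a b; first by case: a.
move=> ab fE.
have step (k : nat) (kn : k < n) : forall (w := inord k : 'I_n.+1) (z := inord k.+1 : 'I_n.+1),
    f z = if w == a then f b else if w == b then f a else f w.
  move=> w z; rewrite -[LHS]fE.
  have -> : ord_pred z = w.
    apply: val_inj; rewrite /= !inordK; try lia.
    by rewrite (_ : (k.+1 + n.+1).-1 = k + n.+1) ?modnDr ?modn_small; lia.
  by case: tpermP => [->|->|/eqP/negPf -> /eqP/negPf -> //]; rewrite ?eqxx //;
    case: eqVneq ab => [->|//]; rewrite ltnn.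
(* Going up from 0, the color changes to [f b] just after [a] and to [f a] just after [b]. *)
have main (k : nat) : k <= n -> f (inord k) =
    if k <= a then f ord0 else if k <= b then f b else f a.
  elim: k => [_|k IH kn]; first by rewrite leq0n; congr f; apply: val_inj; rewrite /= inordK.
  rewrite step // IH; last lia.
  rewrite -!(inj_eq val_inj) /= inordK; last lia.
  have bn := ltn_ord b.
  by repeat case: ifP; move=> *; do ?[reflexivity | lia].
have f0 : f ord0 = f a by rewrite -[in RHS](inord_val a) main ?leqnn // -ltnS.
move=> z; rewrite -[in LHS](inord_val z) main -1?ltnS // f0.
by repeat case: ifP; move=> *; do ?[reflexivity | lia].
Qed.

(* Moving the transposition [tperm a b] to the end conjugates the transpositions
   of Q, which leaves n - 2 transpositions with product the cycle followed by
   [tperm a b]; these admit an invariant coloring with two colors. *)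
Lemma factorization_split n (P Q : seq {perm 'I_n}) (a b : 'I_n) :
  (forall p, p \in P ++ Q -> is_transposition p) ->
  (size P + size Q).+2 <= n -> a < b ->
  ((\prod_(p <- P) p) * tperm a b * (\prod_(p <- Q) p))%g = descending_cycle n ->
  (forall p z, p \in P -> (a < p z <= b) = (a < z <= b)) /\
  (forall p z, p \in Q -> (a <= p z < b) = (a <= z < b)).
Proof.
move=> PQtr sz ab prod.
pose s := tperm a b; pose L := P ++ [seq (p ^ s)%g | p <- Q].
have [|f [fL nf]] := @invariant_coloring n L.
  move=> p; rewrite mem_cat => /orP[pP|/mapP[q qQ ->]].
    by apply: PQtr; rewrite mem_cat pP.
  have [|x [y [xy ->]]] := PQtr q; first by rewrite mem_cat qQ orbT.
  by exists (s x), (s y); rewrite tpermJ (inj_eq perm_inj).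
have LE : (\prod_(p <- L) p)%g = (descending_cycle n * s)%g.
  rewrite big_cat big_map /= -(big_morph (conjg^~ s) (fun x y => conjMg x y s) (conj1g s)).
  by rewrite -prod conjgE tpermV !mulgA.
have fS (z : 'I_n) : f z = if a < z <= b then f b else f a.
  apply: (split_cycle_coloring (f := f) ab) => w; rewrite -[RHS](prod_invariant fL) LE permM.
  by congr (f (s _)); rewrite permE.
(* A single color would give [n <= 1 + (n - 2)]. *)
have fab : f a != f b.
  apply/eqP => fab; have : #|[set f z | z : 'I_n]| <= 1.
    rewrite -(cards1 (f a)); apply/subset_leq_card/fintype.subsetP => w /imsetP[z _ ->].
    by rewrite inE fS -fab; case: ifP.
  move: nf sz; rewrite size_cat size_map => nf sz c1.
  by have := leq_ltn_trans nf (leq_ltn_trans (leq_add c1 (leqnn _)) sz); rewrite ltnn.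
have LX p z : p \in L -> (a < p z <= b) = (a < z <= b).
  move=> pL; move: (fL p z pL); rewrite (fS z) (fS (p z)).
  by case: ifP; case: ifP => // _ _ /eqP; rewrite ?(negPf fab) // eq_sym (negPf fab).
split=> p z pI; first by apply: LX; rewrite mem_cat pI.
(* Since [s] maps [[a, b)] onto [(a, b]], undoing the conjugation turns invariance of [(a, b]] into
   invariance of [[a, b)]. *)
have sX (w : 'I_n) : (a < s w <= b) = (a <= w < b).
  by rewrite /s; case: tpermP => [->|->|/eqP + /eqP]; rewrite -?(inj_eq val_inj) /=; lia.
have := LX (p ^ s)%g (s z); rewrite permJ !sX; apply.
by rewrite mem_cat; apply/orP; right; apply/mapP; exists p.
Qed.

End TranspositionFactorizations.

(** * Greedy trails as orbits under prefix products *)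

Section Trails.
Local Open Scope nat_scope.

(** Sends [u] to the vertex where its greedy trail stands once the labels below [j] have been
    passed, taken or not. *)
Definition walk n m (s : m.-tuple {perm 'I_n}) (j : nat) : {perm 'I_n} :=
  (\prod_(p <- take j s) p)%g.

Definition uses n m (s : m.-tuple {perm 'I_n}) (u : 'I_n) (k : 'I_m) : bool :=
  tnth s k (walk s k u) != walk s k u.

Lemma walk0 n m (s : m.-tuple {perm 'I_n}) u : walk s 0 u = u.
Proof. by rewrite /walk take0 big_nil perm1. Qed.

Lemma walkS n m (s : m.-tuple {perm 'I_n}) (k : 'I_m) u :
  walk s k.+1 u = tnth s k (walk s k u).
Proof.
rewrite /walk (take_nth 1%g) ?size_tuple // -cats1 big_cat big_seq1 permM.
by rewrite (tnth_nth 1%g).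
Qed.

(** Labels strictly increase along a trail, so the largest [m - k] over the available labels [k]
    drops at each step. *)
Lemma greedy_trail_exists n m (G : labeled_graph n m) (used : seq 'I_m) (x : vertex G) :
  exists t, greedy_trail used x t.
Proof.
suff main d : forall used (x : vertex G),
    (forall k, available used x k -> m - k <= d) -> exists t, greedy_trail used x t.
  by apply: (main m) => k _; apply: leq_subr.
elim: d => [|d IH] {}used {}x bound.
  exists [::]; apply: greedy_stop => k /bound; have := ltn_ord k; lia.
have [[k0 k0P]|none] := pselect (exists k, available used x k); last first.
  by exists [::]; apply: greedy_stop => k kP; apply: none; exists k.
have := @arg_minnP _ k0 (fun k => `[< available used x k >]) (@nat_of_ord m) (asboolT k0P).
case=> k /asboolP kP kmin; have [[y xy] _] := kP.
have [|t ty] := IH (rcons used k) y.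
  move=> j [_ /(_ k)]; rewrite mem_rcons mem_head => /(_ isT) kj.
  by have := bound _ kP; have := ltn_ord j; lia.
exists (k :: t); apply: greedy_step xy ty => //.
by move=> j jP; apply: kmin; apply/asboolP.
Qed.

(** The time [M] ties the trail to the prefix products: used labels lie below [M], available ones do
    not. After a step along [k] this holds again with [M = k + 1]. *)
Lemma greedy_trail_mem n m (s : m.-tuple {perm 'I_n}) u used x t :
  (forall k, is_transposition (tnth s k)) ->
  @greedy_trail n m (graph_of_seq s) used x t ->
  forall M : nat, x = walk s M u -> (forall i, i \in used -> i < M) ->
  (forall j, available used x j -> M <= j) ->
  forall k : 'I_m, k \in t <-> M <= k /\ uses s u k.
Proof.
move=> trs; have edgeP (k : 'I_m) (v : 'I_n) : tnth s k v != v ->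
    @edge n m (graph_of_seq s) k v (tnth s k v).
  have [a [b [ab skE]]] := trs k; rewrite skE => mv.
  split; last by case/(tperm_neqP _ ab): mv => ->; rewrite skE ?tpermL ?tpermR // tpermC.
  by apply/eqP; rewrite eq_sym.
have stay (M N : nat) : N <= m -> M <= N ->
    (forall k : 'I_m, M <= k < N -> tnth s k (walk s M u) = walk s M u) ->
    walk s N u = walk s M u.
  elim: N => [_|N IH Nm MN fix_]; first by rewrite leqn0 => /eqP ->.
  move: MN; rewrite leq_eqVlt => /orP[/eqP -> //|MN].
  rewrite (walkS s (Ordinal Nm)) /= IH ?fix_ //=; try lia.
  by move=> k kP; apply: fix_; lia.
elim=> {used x t} [used x none|used x k y t avk kmin xy _ IH] M xE usedM avM j.
  rewrite in_nil; split=> // -[Mj].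
  have fix_ (i : 'I_m) : M <= i -> tnth s i (walk s M u) = walk s M u.
    move=> Mi; apply/eqP; apply: contra_notT (none i) => mv; rewrite -xE in mv.
    split; first by exists (tnth s i x); apply: edgeP.
    by move=> i' /usedM i'M; lia.
  rewrite /uses (stay M j) ?fix_ ?eqxx ?(ltnW (ltn_ord _)) //.
  by move=> i /andP[Mi _]; apply: fix_.
have Mk := avM _ avk.
(* A factor in this range that moved [x] would be an available label smaller than [k]. *)
have fix_ (i : 'I_m) : M <= i < k -> tnth s i (walk s M u) = walk s M u.
  case/andP=> Mi ik; apply/eqP; rewrite -xE; apply/negPn/negP => mv.
  suff /kmin : available used x i by lia.
  split; first by exists (tnth s i x); apply: edgeP.
  by move=> i' /usedM i'M; lia.
have walkE (i : nat) : M <= i <= k -> walk s i u = walk s M u.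
  case/andP=> Mi ik; apply: stay => //; first by have := ltn_ord k; lia.
  by move=> i' i'P; apply: fix_; lia.
have [xny kE] := xy.
have yE : y = walk s k.+1 u by rewrite walkS walkE ?Mk ?leqnn // -xE kE tpermL.
have := IH k.+1 yE _ _ j; rewrite inE => {}IH.
have kuses : uses s u k.
  by rewrite /uses -walkS -yE walkE ?Mk ?leqnn // -xE; apply/eqP => /esym.
have [] : j \in t <-> k < j /\ uses s u j.
  apply: IH => [i|i [_ /(_ k)]].
    by rewrite mem_rcons inE => /orP[/eqP -> //|/usedM]; lia.
  by rewrite mem_rcons mem_head; apply.
move=> jt tj; split.
  by case/orP=> [/eqP ->//|/jt[kj ju]]; split=> //; lia.
case=> Mj ju; case: (ltngtP j k) => [jk|kj|/val_inj -> ]; last by rewrite eqxx.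
  by move: ju; rewrite /uses walkE ?fix_ ?eqxx; lia.
by rewrite tj ?orbT.
Qed.

Lemma trail_usesP n m (s : m.-tuple {perm 'I_n}) (u : 'I_n) (k : 'I_m) :
  (forall k, is_transposition (tnth s k)) ->
  @trail_uses n m (graph_of_seq s) u k <-> uses s u k.
Proof.
move=> trs; have usesE t : @greedy_trail n m (graph_of_seq s) [::] u t ->
    k \in t <-> uses s u k.
  move=> ut; have [||j _|kt tk] // := greedy_trail_mem (u := u) (M := 0) trs ut _ _ _ k.
    by rewrite walk0.
  by split=> [/kt[]|ku] //; apply: tk.
split=> [[t [ut kt]]|ku]; first exact/(usesE t).
have [t ut] := @greedy_trail_exists n m (graph_of_seq s) [::] u.
by exists t; split=> //; apply/usesE.
Qed.

End Trails.

(** * Trails and the two sides of a chord *)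

Section TrailsAndChords.
Local Open Scope nat_scope.
Variables (n : nat) (s : (n.-1).-tuple {perm 'I_n}).
Hypothesis hs : descending_factorization s.

Lemma factor_transposition p : p \in (s : seq _) -> is_transposition p.
Proof. by case/tnthP => k ->; apply: hs.1. Qed.

Lemma factors_preserve_sides (k : 'I_(n.-1)) (a b : 'I_n) :
  a < b -> tnth s k = tperm a b ->
  (forall (j : 'I_(n.-1)) z, j < k -> (a < tnth s j z <= b) = (a < z <= b)) /\
  (forall (j : 'I_(n.-1)) z, k < j -> (a <= tnth s j z < b) = (a <= z < b)).
Proof.
move=> ab skE; have kn := ltn_ord k.
have sE : tval s = take k s ++ tperm a b :: drop k.+1 s.
  by rewrite -skE (tnth_nth 1%g) -drop_nth ?size_tuple // cat_take_drop.
have [] := @factorization_split n (take k s) (drop k.+1 s) a b _ _ ab.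
- move=> p; rewrite mem_cat => pI; apply: factor_transposition.
  by rewrite sE mem_cat inE; case/orP: pI => ->; rewrite ?orbT.
- by rewrite size_takel ?size_drop !size_tuple; lia.
- by rewrite -hs.2 sE big_cat big_cons -sE /= mulgA.
move=> before after; split=> j z jk; [apply: before|apply: after];
  rewrite (tnth_nth 1%g).
  by rewrite -(nth_take _ jk) mem_nth // size_takel ?size_tuple // ltnW.
have -> : nat_of_ord j = k.+1 + (j - k.+1) by lia.
by rewrite -nth_drop mem_nth // size_drop size_tuple; have := ltn_ord j; lia.
Qed.

(** Factors before [k] preserve [(a, b]], factor [k] carries it to [[a, b)], and later factors
    preserve [[a, b)]. *)
Lemma walk_side (k : 'I_(n.-1)) (a b u : 'I_n) (j : nat) :
  a < b -> tnth s k = tperm a b -> j <= n.-1 ->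
  if j <= k then (a < walk s j u <= b) = (a < u <= b)
  else (a <= walk s j u < b) = (a < u <= b).
Proof.
move=> ab skE; have [before after] := factors_preserve_sides ab skE.
elim: j => [_|j IH jn]; first by rewrite leq0n walk0.
have := IH (ltnW jn); rewrite (walkS s (Ordinal jn)) /=.
case: (ltngtP j k) => [jk|kj|jk] <-; first by rewrite before.
  by rewrite after.
have -> : Ordinal jn = k by apply: val_inj.
rewrite skE; case: tpermP => [->|->|/eqP + /eqP]; rewrite -?(inj_eq val_inj) /=; lia.
Qed.

Lemma walk_closed_side (k : 'I_(n.-1)) (a b u : 'I_n) (j : nat) :
  a < b -> tnth s k = tperm a b -> j <= n.-1 ->
  if a < u <= b then a <= walk s j u <= b else ~~ (a < walk s j u < b).
Proof. by move=> ab skE /(walk_side u ab skE); case: ifP; case: ifP; lia. Qed.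

(** The ends of a used edge are the positions of the walk just before and just after it. *)
Lemma uses_end_closed_side (k l : 'I_(n.-1)) (a b v w u : 'I_n) :
  a < b -> tnth s k = tperm a b -> tnth s l = tperm v w -> uses s u l ->
  if a < u <= b then (a <= v <= b) && (a <= w <= b)
  else ~~ (a < v < b) && ~~ (a < w < b).
Proof.
move=> ab skE slE; rewrite /uses slE => ul.
have ln := ltn_ord l.
have := walk_closed_side u ab skE (ltnW ln).
have := walk_closed_side u ab skE ln.
rewrite walkS slE.
by move: ul; case: tpermP => [->|->|]; rewrite ?eqxx // => _; case: ifP => _ -> ->.
Qed.

(** The walk that stands at [b] just before factor [k] started in [(a, b]]; the one that stands at
    [a] started outside. *)
Lemma uses_on_side (k : 'I_(n.-1)) (a b : 'I_n) (c : bool) :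
  a < b -> tnth s k = tperm a b ->
  exists u, uses s u k /\ (a < u <= b) = c.
Proof.
move=> ab skE; exists ((walk s k)^-1%g (if c then b else a)).
have := walk_side ((walk s k)^-1%g (if c then b else a)) ab skE (ltnW (ltn_ord k)).
rewrite leqnn /uses permKV skE => <-; case: c; rewrite ?tpermL ?tpermR -(inj_eq val_inj) /=; lia.
Qed.

(** If no chord separates arcs [i < j], every factor preserves [[i, j)]. Their product does not: it
    sends [i] to its cyclic predecessor, which lies outside. *)
Lemma arcs_separated (i j : 'I_n) :
  (forall k (a b : 'I_n), a < b -> tnth s k = tperm a b ->
     (a < i <= b) = (a < j <= b)) -> i = j.
Proof.
wlog ij : i j / i < j.
  move=> W H; case: (ltngtP i j) => [ij|ji|/val_inj //]; first exact: W.
  by apply/esym/W => // k a b ab skE; rewrite (H k a b).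
move=> H; pose f (z : 'I_n) := i <= z < j.
have fs p z : p \in (s : seq _) -> f (p z) = f z.
  case/tnthP => k ->; have [x [y [xy skE]]] := hs.1 k.
  wlog {xy} xy : x y skE / x < y.
    move=> W; case: (ltngtP x y) => [lt|lt|/val_inj E]; first exact: (W x y).
      by apply: (W y x) => //; rewrite skE tpermC.
    by rewrite E eqxx in xy.
  have := H k x y xy skE.
  by rewrite /f skE; case: tpermP => [->|->|_ _ //]; lia.
have := prod_invariant fs i; rewrite hs.2 permE /f /= leqnn ij.
have jn := ltn_ord j.
case: (posnP i) => [->|i0]; first by rewrite add0n modn_small; lia.
have -> : (i + n).-1 = i.-1 + n by lia.
by rewrite modnDr modn_small; lia.
Qed.

(** An earlier copy of the transposition [(x y)] would have to preserve [(x, y]], but it sends [x]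
    to [y]. *)
Lemma factors_distinct (k l : 'I_(n.-1)) : tnth s k = tnth s l -> k = l.
Proof.
wlog kl : k l / k < l.
  move=> W E; case: (ltngtP k l) => [lt|lt|/val_inj //]; first exact: W.
  by apply/esym/W.
have [x [y [xy slE]]] := hs.1 l.
wlog {xy} xy : x y slE / x < y.
  move=> W; case: (ltngtP x y) => [lt|lt|/val_inj E]; first exact: (W x y).
    by apply: (W y x) => //; rewrite slE tpermC.
  by rewrite E eqxx in xy.
have [before _] := factors_preserve_sides xy slE.
by move=> E; have := before k x kl; rewrite E slE tpermL; lia.
Qed.

End TrailsAndChords.

(** * Chords of a circle as zero sets of affine functions *)

Section Chords.
Local Open Scope classical_set_scope.
Local Open Scope ring_scope.
Variable R : realType.

Lemma cos_gt_of_lt (h x : R) : h <= pi -> `|x| < h -> cos h < cos x.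
Proof.
move=> hpi xh; have x0 := normr_ge0 x.
by rewrite -(cos_norm x) ltr_cos // in_itv /=; apply/andP; split; lra.
Qed.

Lemma cos_lt_of_gt (h x : R) : 0 <= h -> h < `|x| < 2 * pi - h -> cos x < cos h.
Proof.
move=> h0 /andP[hx xh]; have x0 := normr_ge0 x.
rewrite -(cos_norm x); case: (leP `|x| pi) => [xpi|pix].
  by rewrite ltr_cos // in_itv /=; apply/andP; split; lra.
(* Reflection at [pi] brings the argument back to where the cosine decreases. *)
have <- : cos (2 * pi - `|x|) = cos `|x|.
  rewrite -cosN opprB -[LHS](cosD2pi (`|x| - 2 * pi)).
  by congr cos; ring.
by rewrite ltr_cos ?in_itv /= //; try (apply/andP; split); lra.
Qed.

Definition between (z w : R * R) (t : R) : R * R :=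
  (line_path z.1 w.1 t, line_path z.2 w.2 t).

Lemma between0 z w : between z w 0 = z.
Proof. by rewrite /between /line_path !subr0 !mul1r !mul0r !addr0; case: z. Qed.

Lemma between1 z w : between z w 1 = w.
Proof. by rewrite /between /line_path !subrr !mul1r !mul0r !add0r; case: w. Qed.

Lemma between_continuous z w : continuous (between z w).
Proof.
move=> t.
have cvg1 (a b : R) : line_path a b x @[x --> t] --> line_path a b t.
  apply: cvgD; apply: cvgMl; last exact: cvg_id.
  by apply: cvgB; [exact: cvg_cst|exact: cvg_id].
by apply: (@cvg_pair _ _ _ _ (nbhs (line_path z.1 w.1 t)) (nbhs (line_path z.2 w.2 t)));
  apply: cvg1.
Qed.

(** A convex set is the union of the segments issuing from one of its points. *)
Lemma convex_connected (A : set (R * R)) :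
  (forall z w t, A z -> A w -> 0 <= t <= 1 -> A (between z w t)) -> connected A.
Proof.
move=> Aconv; have [->|/set0P[z Az]] := eqVneq A set0; first exact: connected0.
have -> : A = \bigcup_(w in A) (between z w @` `[0, 1]).
  apply/seteqP; split=> [w Aw|_ [w Aw [t + <-]]].
    by exists w => //; exists 1; rewrite ?between1 //= in_itv /= ler01 lexx.
  by rewrite /= in_itv /=; apply: Aconv.
apply: bigcup_connected => [|w _].
  by exists z => w _; exists 0; rewrite ?between0 //= in_itv /= ler01 lexx.
apply: connected_continuous_connected; first exact: segment_connected.
exact/continuous_subspaceT/between_continuous.
Qed.

Variables (n : nat) (D : clockwise_points R n).

(** With the two angles written [m + h] and [m - h], the line through the points has normal
    direction [m] and signed distance [r cos h] from the center. *)
Definition angular_middle (a b : 'I_n) : R := (angle D a + angle D b) / 2.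
Definition half_angle (a b : 'I_n) : R := (angle D a - angle D b) / 2.

(* Vanishes on the line through points a and b and is positive on the side of
   the arc swept clockwise from a to b. *)
Definition chord_side (a b : 'I_n) (z : R * R) : R :=
  (z.1 - (center D).1) * cos (angular_middle a b)
  + (z.2 - (center D).2) * sin (angular_middle a b)
  - radius D * cos (half_angle a b).

Lemma chord_side_between a b z w t :
  chord_side a b (between z w t) = (1 - t) * chord_side a b z + t * chord_side a b w.
Proof. by rewrite /chord_side /between /line_path /=; ring. Qed.

Lemma chord_side_continuous a b : continuous (chord_side a b).
Proof.
move=> z; apply: cvgB; last exact: cvg_cst.
by apply: cvgD; apply: cvgMl; apply: cvgB; try exact: cvg_cst; [exact: cvg_fst|exact: cvg_snd].
Qed.

Lemma chord_side_circle a b t :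
  chord_side a b (circle_point D t)
  = radius D * (cos (t - angular_middle a b) - cos (half_angle a b)).
Proof. by rewrite /chord_side /circle_point /= cosB; ring. Qed.

Lemma half_angle_bounds (a b : 'I_n) : (a < b)%N -> 0 < half_angle a b < pi.
Proof.
move=> ab; have := angle_decreasing D ab; have := angle_one_turn D a b.
by rewrite /half_angle => ? ?; apply/andP; split; lra.
Qed.

Lemma chord_side_gt0 (a b : 'I_n) t : (a < b)%N ->
  angle D b < t < angle D a -> 0 < chord_side a b (circle_point D t).
Proof.
move=> /half_angle_bounds/andP[h0 hpi] /andP[bt ta].
rewrite chord_side_circle mulr_gt0 ?radius_gt0 // subr_gt0 cos_gt_of_lt ?ltW //.
by rewrite ltr_norml /angular_middle /half_angle; apply/andP; split; lra.
Qed.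

(** Both ranges of [t] describe the same complementary arc, one turn apart. *)
Lemma chord_side_lt0 (a b : 'I_n) t : (a < b)%N ->
  angle D a < t < angle D b + 2 * pi \/ angle D a - 2 * pi < t < angle D b ->
  chord_side a b (circle_point D t) < 0.
Proof.
move=> /half_angle_bounds/andP[h0 hpi] tP.
rewrite chord_side_circle pmulr_rlt0 ?radius_gt0 // subr_lt0 cos_lt_of_gt ?ltW //.
by move: tP h0 hpi; rewrite ltr_normr ltr_norml /angular_middle /half_angle =>
  -[] /andP[? ?] ? ?; apply/andP; split; try apply/andP; try apply/orP;
  first [split; lra | left; lra | right; lra].
Qed.

Lemma chord_side_end (a b v : 'I_n) : v \in [:: a; b] ->
  chord_side a b (circle_point D (angle D v)) = 0.
Proof.
rewrite !inE chord_side_circle => /orP[]/eqP ->.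
  rewrite (_ : _ - angular_middle a b = half_angle a b) ?subrr ?mulr0 //.
  by rewrite /angular_middle /half_angle; field.
rewrite (_ : _ - angular_middle a b = - half_angle a b) ?cosN ?subrr ?mulr0 //.
by rewrite /angular_middle /half_angle; field.
Qed.

Lemma chord_side_vertex (a b v : 'I_n) : (a < b)%N -> v \notin [:: a; b] ->
  if (a <= v <= b)%N then 0 < chord_side a b (circle_point D (angle D v))
  else chord_side a b (circle_point D (angle D v)) < 0.
Proof.
rewrite !inE -!(inj_eq val_inj) /= => ab vab; case: ifP => avb.
  by apply: chord_side_gt0 => //; rewrite !angle_decreasing //; lia.
apply: chord_side_lt0 => //; have [va|av] := ltnP v a; [left|right];
  apply/andP; split; rewrite ?angle_decreasing ?angle_one_turn //; try lia.
by have := angle_one_turn D a v; lra.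
Qed.

Lemma chord_side_arc (a b i : 'I_n) z : (a < b)%N -> arc D i z ->
  if (a < i <= b)%N then 0 < chord_side a b z else chord_side a b z < 0.
Proof.
have mono (u v : 'I_n) : (u <= v)%N -> angle D v <= angle D u.
  by rewrite leq_eqVlt => /orP[/eqP/val_inj -> //|/(angle_decreasing D)/ltW].
have bn := ltn_ord b; have an := ltn_ord a; have i_n := ltn_ord i.
move=> ab [t /= /andP[ti it] <-]; have turn := angle_one_turn D a i.
(* Arc 0 lies outside every [(a, b]]; its angles start one turn below that of point 0, hence the
   second range of [chord_side_lt0]. *)
have [i0|i0] := posnP i.
  rewrite i0 /= in ti *; apply: chord_side_lt0 => //; right.
  have bi : angle D (ord_pred i) <= angle D b.
    by apply: mono; rewrite /= i0 add0n modn_small; lia.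
  have ia : angle D a <= angle D i by apply: mono; rewrite i0.
  by apply/andP; split; lra.
rewrite (gtn_eqF i0) in ti.
have pE : nat_of_ord (ord_pred i) = i.-1.
  by rewrite /= (_ : (i + n).-1 = i.-1 + n)%N ?modnDr ?modn_small; lia.
have pi_b := @mono b (ord_pred i); have a_pi := @mono a (ord_pred i).
have ia := @mono i a; have ib := @mono i b.
have pturn := angle_one_turn D (ord_pred i) b.
rewrite pE in pi_b a_pi.
(* The ends [i - 1] and [i] of the arc both lie in [[a, b]] exactly when [a < i <= b]. *)
case: ifP => iab.
  apply: chord_side_gt0 => //; apply/andP; split; [apply: le_lt_trans ti|apply: lt_le_trans it _].
    by apply: ib; lia.
  by apply: a_pi; lia.
apply: chord_side_lt0 => //; have [ib'|bi] := leqP i b; [left|right]; apply/andP; split.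
- by apply: le_lt_trans ti; apply: ia; lia.
- by apply: lt_trans it _.
- by apply: lt_trans ti; lra.
- by apply: lt_le_trans it _; apply: pi_b; lia.
Qed.

Lemma circle_point_disk t : disk D (circle_point D t).
Proof.
rewrite /disk /circle_point /=.
rewrite [leLHS](_ : _ = radius D ^+ 2 * (cos t ^+ 2 + sin t ^+ 2)); last by ring.
by rewrite cos2Dsin2 mulr1 lexx.
Qed.

Lemma disk_convex z w t : disk D z -> disk D w -> 0 <= t <= 1 -> disk D (between z w t).
Proof.
rewrite /disk /between /line_path /= => zD wD /andP[t0 t1].
set x := z.1 - (center D).1 in zD; set y := z.2 - (center D).2 in zD.
set x' := w.1 - (center D).1 in wD; set y' := w.2 - (center D).2 in wD.
have -> : (1 - t) * z.1 + t * w.1 - (center D).1 = (1 - t) * x + t * x'.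
  by rewrite /x /x'; ring.
have -> : (1 - t) * z.2 + t * w.2 - (center D).2 = (1 - t) * y + t * y'.
  by rewrite /y /y'; ring.
(* The convexity defect of the squared norm is [t (1 - t)] times the squared distance of the two
   points. *)
have -> : ((1 - t) * x + t * x') ^+ 2 + ((1 - t) * y + t * y') ^+ 2 =
  (1 - t) * (x ^+ 2 + y ^+ 2) + t * (x' ^+ 2 + y' ^+ 2)
  - (1 - t) * t * ((x - x') ^+ 2 + (y - y') ^+ 2) by ring.
have : 0 <= (1 - t) * t * ((x - x') ^+ 2 + (y - y') ^+ 2).
  by apply: mulr_ge0; [apply: mulr_ge0; rewrite ?subr_ge0|rewrite addr_ge0 ?sqr_ge0].
have t1' : 0 <= 1 - t by rewrite subr_ge0.
have := ler_wpM2l t1' zD; have := ler_wpM2l t0 wD; lra.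
Qed.

(** In the frame rotated by [m], a zero has first coordinate [r cos h], so lying in the disk bounds
    its second coordinate [y] by [r sin h] in absolute value. *)
Lemma zero_chord_side (a b : 'I_n) z : (a < b)%N -> disk D z -> chord_side a b z = 0 ->
  exists2 t, 0 <= t <= 1 &
    between (circle_point D (angle D a)) (circle_point D (angle D b)) t = z.
Proof.
move=> ab zD zL; have /andP[h0 hpi] := half_angle_bounds ab.
set m := angular_middle a b in zL; set h := half_angle a b in zL h0 hpi.
have aE : angle D a = m + h by rewrite /m /h /angular_middle /half_angle; field.
have bE : angle D b = m - h by rewrite /m /h /angular_middle /half_angle; field.
have S0 : 0 < radius D * sin h by rewrite mulr_gt0 ?radius_gt0 ?sin_gt0_pi ?h0.
set u := z.1 - (center D).1; set v := z.2 - (center D).2.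
pose y := v * cos m - u * sin m.
have xE : u * cos m + v * sin m = radius D * cos h.
  by apply/eqP; rewrite -subr_eq0 -[X in X == _]/(chord_side a b z) zL.
have y2 : y ^+ 2 <= (radius D * sin h) ^+ 2.
  have -> : y ^+ 2 = (u ^+ 2 + v ^+ 2) * (cos m ^+ 2 + sin m ^+ 2) - (u * cos m + v * sin m) ^+ 2.
    by rewrite /y; ring.
  rewrite cos2Dsin2 mulr1 xE !exprMn sin2cos2.
  have := zD; rewrite /disk /= -/u -/v; lra.
have yB : `|y| <= radius D * sin h.
  by rewrite -(ler_pXn2r (n := 2%N)) ?nnegrE ?normr_ge0 ?(ltW S0) // real_normK ?num_real.
(* Point [a] has [y = r sin h] and point [b] has [y = - r sin h]; the parameter interpolates between
   them. *)
exists ((1 - y / (radius D * sin h)) / 2).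
  have : -1 <= y / (radius D * sin h) <= 1.
    by rewrite ler_pdivlMr // ler_pdivrMr // mulN1r mul1r -ler_norml.
  by move=> /andP[? ?]; apply/andP; split; lra.
have uE : z.1 = (center D).1 + (radius D * cos h * cos m - y * sin m).
  rewrite -xE /y; transitivity ((center D).1 + u * (cos m ^+ 2 + sin m ^+ 2)); last by ring.
  by rewrite cos2Dsin2 /u; ring.
have vE : z.2 = (center D).2 + (radius D * cos h * sin m + y * cos m).
  rewrite -xE /y; transitivity ((center D).2 + v * (cos m ^+ 2 + sin m ^+ 2)); last by ring.
  by rewrite cos2Dsin2 /v; ring.
rewrite [RHS]surjective_pairing uE vE /between /circle_point /line_path /= aE bE.
have Sne := lt0r_neq0 S0.
move: (Sne); rewrite mulf_eq0 negb_or => /andP[rne sne].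
by rewrite cosD cosB sinD sinB; congr pair; field; rewrite rne sne.
Qed.

End Chords.

Local Open Scope ring_scope.

Lemma convex_comb_gt0 (R : realFieldType) (x y t : R) :
  0 <= x -> 0 < y -> 0 < t <= 1 -> 0 < (1 - t) * x + t * y.
Proof.
move=> x0 y0 /andP[t0 t1]; apply: ltr_wpDl; last exact: mulr_gt0.
by apply: mulr_ge0 => //; rewrite subr_ge0.
Qed.

(** * Regions as sign cells, and their matching with arcs *)

Section Regions.
Local Open Scope classical_set_scope.
Local Open Scope ring_scope.
Variables (R : realType) (n m : nat) (D : clockwise_points R n) (G : labeled_graph n m).
Variables lo hi : 'I_m -> 'I_n.
Hypothesis lo_lt_hi : forall k, (lo k < hi k)%N.
Hypothesis chordE : forall k, chord D G k =
  segment (circle_point D (angle D (lo k))) (circle_point D (angle D (hi k))).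

Definition arc_side (i : 'I_n) (k : 'I_m) : bool := (lo k < i <= hi k)%N.

Definition signed_side (e : 'I_m -> bool) (k : 'I_m) (z : R * R) : R :=
  (-1) ^+ (~~ e k) * chord_side D (lo k) (hi k) z.

Lemma signed_side_between e k z w t :
  signed_side e k (between z w t)
  = (1 - t) * signed_side e k z + t * signed_side e k w.
Proof. by rewrite /signed_side chord_side_between; ring. Qed.

Lemma signed_side_continuous e k : continuous (signed_side e k).
Proof. by move=> z; apply: cvgMr; apply: chord_side_continuous. Qed.

Lemma signed_sideN e f k z : e k != f k -> signed_side e k z = - signed_side f k z.
Proof. by rewrite /signed_side; case: (e k); case: (f k) => // _; ring. Qed.

Definition sign_cell (e : 'I_m -> bool) : set (R * R) :=
  [set z | disk D z /\ forall k, 0 < signed_side e k z].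

Definition closed_sign_cell (e : 'I_m -> bool) : set (R * R) :=
  [set z | disk D z /\ forall k, 0 <= signed_side e k z].

Definition signs (z : R * R) (k : 'I_m) : bool := 0 < chord_side D (lo k) (hi k) z.

Lemma chord_zero k z : disk D z ->
  chord D G k z <-> chord_side D (lo k) (hi k) z = 0.
Proof.
move=> zD; rewrite chordE; split=> [[t _ <-]|].
  rewrite (chord_side_between D _ _ _ _ t) !chord_side_end ?mulr0 ?addr0 //.
    by rewrite !inE eqxx orbT.
  by rewrite !inE eqxx.
by case/(zero_chord_side (lo_lt_hi k) zD) => t tI tE; exists t; rewrite //= in_itv.
Qed.

Lemma disk_minus_chordsP z : disk_minus_chords D G z <->
  disk D z /\ forall k, chord_side D (lo k) (hi k) z != 0.
Proof.
split=> -[zD zk]; split=> //.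
  by move=> k; apply/eqP => /(chord_zero k zD) kz; apply: zk; exists k.
by move=> [k _ /(chord_zero k zD)]; apply/eqP.
Qed.

Lemma disk_minus_chords_signs z : disk_minus_chords D G z -> sign_cell (signs z) z.
Proof.
case/disk_minus_chordsP => zD zk; split=> // k; rewrite /signed_side /signs.
have := zk k; rewrite neq_lt => /orP[lt0|gt0].
  by rewrite (lt_gtF lt0) expr1 mulN1r oppr_gt0.
by rewrite gt0 expr0 mul1r.
Qed.

Lemma sign_cell_sub e : sign_cell e `<=` disk_minus_chords D G.
Proof.
move=> z [zD ze]; apply/disk_minus_chordsP; split=> // k; apply/eqP => z0.
by have := ze k; rewrite /signed_side z0 mulr0 ltxx.
Qed.

Lemma sign_cell_connected e : connected (sign_cell e).
Proof.
apply: convex_connected => z w t [zD ze] [wD we] tI; split; first exact: disk_convex.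
move=> k; rewrite signed_side_between; have := ze k; have := we k.
move: tI => /andP[t0 t1] wk zk.
have [->|tn0] := eqVneq t 0; first by rewrite subr0 mul1r mul0r addr0.
by apply: convex_comb_gt0; rewrite ?(ltW zk) // lt_neqAle eq_sym tn0 t0.
Qed.

(** The cell is connected, being convex. A component that left it would, its image under some
    [signed_side] being an interval, contain a zero, that is a point of a chord. *)
Lemma region_sign_cell z e : sign_cell e z ->
  connected_component (disk_minus_chords D G) z = sign_cell e.
Proof.
move=> ze; apply/seteqP; split; last first.
  apply: connected_component_max ze _ _; first exact: sign_cell_sub.
  exact: sign_cell_connected.
move=> w zw; have wA := connected_component_sub zw.
have [wD wk] := (disk_minus_chordsP w).1 wA; split=> // k.
rewrite ltNge; apply/negP => wle.
have /connected_intervalP itv : connected (signed_side e k @`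
    connected_component (disk_minus_chords D G) z).
  apply: connected_continuous_connected; first exact: component_connected.
  exact/continuous_subspaceT/signed_side_continuous.
have [v zv v0] : (signed_side e k @` connected_component (disk_minus_chords D G) z) 0.
  apply: (itv (signed_side e k w) (signed_side e k z)).
  - by exists w.
  - by exists z => //; apply: connected_component_refl; apply: sign_cell_sub ze.
  - by rewrite wle ltW //; case: ze.
have [_ /(_ k)] := (disk_minus_chordsP v).1 (connected_component_sub zv).
move/eqP: v0; rewrite /signed_side mulf_eq0 signr_eq0 /= => /eqP ->.
by rewrite eqxx.
Qed.

Lemma sign_cell_region e z : sign_cell e z -> is_region D G (sign_cell e).
Proof.
move=> ze; exists z; first exact: sign_cell_sub ze.
by rewrite (region_sign_cell ze).
Qed.

(** Moving [w] slightly towards a point [u] of the cell makes all the weak inequalities strict. *)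
Lemma closure_sign_cell e u : sign_cell e u -> closed_sign_cell e `<=` closure (sign_cell e).
Proof.
move=> [uD ue] w [wD we] B wB.
have /(_ B wB) : between w u @ 0^'+ --> w.
  rewrite -[X in _ --> X](between0 w u); apply: cvg_at_right_filter.
  exact: between_continuous.
move=> Bnear.
have near_t : \forall t \near (0 : R)^'+, (B (between w u t) /\ 0 < t) /\ t < 1.
  by apply: filterI; [apply: filterI; [|exact: nbhs_right_gt]|exact: nbhs_right_lt].
have [t [[Bt t0] t1]] := @filter_ex _ _ (at_right_proper_filter _) _ near_t.
exists (between w u t); split=> //; split.
  by apply: disk_convex => //; rewrite !ltW.
by move=> k; rewrite signed_side_between; apply: (convex_comb_gt0 (we k) (ue k)); rewrite t0 ltW.
Qed.

Lemma closure_sign_cell_ge0 e k z : closure (sign_cell e) z -> 0 <= signed_side e k z.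
Proof.
have clo : closed (signed_side e k @^-1` [set x | 0 <= x]).
  exact: (continuous_closedP _).1 (@signed_side_continuous e k) _ (@closed_ge _ 0).
move/(@closureS _ _ (signed_side e k @^-1` [set x | 0 <= x])).
rewrite -(closure_id _).1 //; apply => w [_ we]; exact/ltW/we.
Qed.

(** Signed sides are affine, so the two ends of the chord decide whether it lies in the closure; no
    chord point is interior, since cells avoid the chords. *)
Lemma chord_sub_boundary e k u : sign_cell e u ->
  chord D G k `<=` boundary (sign_cell e) <->
  forall l v, v \in [:: lo k; hi k] ->
    0 <= signed_side e l (circle_point D (angle D v)).
Proof.
move=> ue; split=> [bd l v vk|ge0 z].
  have /bd[/closure_sign_cell_ge0 + _] : chord D G k (circle_point D (angle D v)).
    by apply/chord_zero; rewrite ?chord_side_end //; apply: circle_point_disk.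
  exact.
move=> zk; split.
  apply: (closure_sign_cell ue); move: zk; rewrite chordE => -[t t01 <-].
  have tI : 0 <= t <= 1 by move: t01; rewrite /= in_itv.
  rewrite -/(between _ _ t); split.
    by apply: disk_convex tI; apply: circle_point_disk.
  move=> l; rewrite (signed_side_between e l _ _ t); have /andP[t0 t1] := tI.
  by rewrite addr_ge0 // mulr_ge0 ?subr_ge0 // ge0 // !inE eqxx ?orbT.
move/interior_subset/sign_cell_sub => [_]; apply.
by exists k.
Qed.

Lemma arc_sub_cell i : arc D i `<=` sign_cell (arc_side i).
Proof.
move=> z iz; split=> [|k]; first by case: iz => t _ <-; apply: circle_point_disk.
have := chord_side_arc (lo_lt_hi k) iz; rewrite /signed_side /arc_side.
by case: ifP => _; rewrite ?expr0 ?expr1 ?mul1r ?mulN1r ?oppr_gt0.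
Qed.

Lemma vertex_signed_side e k (v : 'I_n) :
  (if e k then lo k <= v <= hi k else ~~ (lo k < v < hi k))%N ->
  0 <= signed_side e k (circle_point D (angle D v)).
Proof.
rewrite /signed_side; have [vk|vk] := boolP (v \in [:: lo k; hi k]).
  by rewrite chord_side_end ?mulr0.
have := chord_side_vertex D (lo_lt_hi k) vk.
have vE : (lo k <= v <= hi k)%N = (lo k < v < hi k)%N.
  by move: vk; rewrite !inE -!(inj_eq val_inj) /=; lia.
rewrite vE; case: (e k) => /=; case: ifP => //= _;
  by rewrite ?expr0 ?expr1 ?mul1r ?mulN1r ?oppr_ge0 => /ltW.
Qed.

Lemma arc_nonempty i : exists z, arc D i z.
Proof.
set lb := if i == 0%N :> nat then angle D i - 2 * pi else angle D i.
have lt : lb < angle D (ord_pred i).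
  rewrite /lb; case: ifP => [_|i0]; first by have := angle_one_turn D i (ord_pred i); lra.
  apply: angle_decreasing => /=; have i_n := ltn_ord i.
  by rewrite (_ : (i + n).-1 = i.-1 + n)%N ?modnDr ?modn_small; lia.
exists (circle_point D ((lb + angle D (ord_pred i)) / 2)), ((lb + angle D (ord_pred i)) / 2) => //=.
by rewrite -/lb; apply/andP; split; lra.
Qed.

(** Stands for [uses s]; the hypotheses below are what the combinatorics of the factorization
    supplies to the geometry. *)
Variable touches : 'I_n -> 'I_m -> bool.
Hypothesis touches_closed_side : forall i k l v, touches i k -> v \in [:: lo k; hi k] ->
  (if arc_side i l then lo l <= v <= hi l else ~~ (lo l < v < hi l))%N.
Hypothesis touches_on_side : forall k c, exists2 i, touches i k & arc_side i k = c.
Hypothesis arc_side_inj : forall i j, (forall k, arc_side i k = arc_side j k) -> i = j.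
Hypothesis ends_inj : forall k l, lo k = lo l -> hi k = hi l -> k = l.

Lemma touches_ge0 i k l v : touches i k -> v \in [:: lo k; hi k] ->
  0 <= signed_side (arc_side i) l (circle_point D (angle D v)).
Proof. by move=> ik vk; apply: vertex_signed_side; apply: touches_closed_side vk. Qed.

Lemma signed_side_vertex_eq0 e k v :
  signed_side e k (circle_point D (angle D v)) = 0 -> v \in [:: lo k; hi k].
Proof.
apply: contra_eqT => /(chord_side_vertex D (lo_lt_hi k)).
move=> sideP; rewrite /signed_side mulf_neq0 ?signr_eq0 //.
by move: sideP; case: ifP => _; [move/lt0r_neq0|move/ltr0_neq0].
Qed.

(** Some arc [x] on the side of [i] touches [k]. If a chord [l] separated [x] from [i], both ends of
    [k] would lie on its two closed sides, hence be ends of [l]; then [k = l], on which the sides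
    agree. *)
Lemma chord_boundary_touches i k :
  chord D G k `<=` boundary (sign_cell (arc_side i)) <-> touches i k.
Proof.
have [u /arc_sub_cell ui] := arc_nonempty i.
rewrite (chord_sub_boundary k ui); split; last first.
  by move=> ik l v; apply: touches_ge0.
move=> iv; have [x xk xi] := touches_on_side k (arc_side i k).
suff <- : x = i by [].
apply: arc_side_inj => l; apply/eqP/negPn/negP => xil.
have v0 v : v \in [:: lo k; hi k] -> v \in [:: lo l; hi l].
  move=> vk; apply: (@signed_side_vertex_eq0 (arc_side x)).
  have := iv l v vk; have := touches_ge0 l xk vk.
  by rewrite (@signed_sideN (arc_side i) (arc_side x)) 1?eq_sym //; lra.
have kl : k = l.
  have := v0 (lo k); have := v0 (hi k); have := lo_lt_hi k; have := lo_lt_hi l.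
  rewrite !inE !eqxx orbT /= => lk ll /(_ isT) + /(_ isT).
  by move=> /orP[]/eqP h /orP[]/eqP h'; (try by apply: ends_inj); move: lk ll; rewrite h h'; lia.
by rewrite -kl xi eqxx in xil.
Qed.

(* Adding the chords one at a time: a cell that the new chord k cuts touches
   chord k, hence agrees on the earlier chords with both arcs that touch k. *)
Lemma cell_has_arc z : (0 < n)%N -> disk_minus_chords D G z ->
  exists i, signs z =1 arc_side i.
Proof.
move=> n0 zA; suff main (K : seq 'I_m) : exists i, {in K, signs z =1 arc_side i}.
  by have [i iE] := main (enum 'I_m); exists i => k; apply: iE; rewrite mem_enum.
have zs := disk_minus_chords_signs zA.
elim: K => [|k K [i iK]]; first by exists (Ordinal n0).
have [ik|ik] := eqVneq (signs z k) (arc_side i k).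
  by exists i => l; rewrite inE => /orP[/eqP ->|/iK].
have [u /arc_sub_cell ui] := arc_nonempty i.
have [zk uk] := (zs.2 k, ui.2 k).
rewrite (@signed_sideN _ (signs z)) 1?eq_sym // in uk.
set x := signed_side (signs z) k z in zk; set y := signed_side (signs z) k u in uk.
have xy : 0 < x - y by lra.
(* The segment from [z] to [u] crosses chord [k] here: the affine function going from [x > 0] to
   [y < 0] vanishes at [t]. *)
pose t := x / (x - y).
have tI : 0 <= t <= 1.
  by rewrite /t divr_ge0 ?ler_pdivrMr ?mul1r ?ltW //; lra.
pose w := between z u t.
have wD : disk D w by apply: disk_convex => //; [exact: zs.1|exact: ui.1].
have wk : chord D G k w.
  apply/chord_zero => //; apply/eqP.
  suff : signed_side (signs z) k w == 0 by rewrite mulf_eq0 signr_eq0.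
  rewrite /w signed_side_between -/x -/y /t; apply/eqP; field.
  by rewrite lt0r_neq0.
have wK l : l \in K -> 0 < signed_side (signs z) l w.
  move=> lK; rewrite /w signed_side_between; have zl := zs.2 l.
  have ul : 0 < signed_side (signs z) l u by rewrite /signed_side iK //; apply: ui.2.
  have [->|tn0] := eqVneq t 0; first by rewrite subr0 mul1r mul0r addr0.
  have /andP[t0 t1] := tI.
  by apply: convex_comb_gt0; rewrite ?(ltW zl) // lt_neqAle eq_sym tn0 t0.
have [j jk jz] := touches_on_side k (signs z k).
exists j => l; rewrite inE => /orP[/eqP -> //|lK].
apply/eqP/negPn/negP => zj.
suff : 0 <= signed_side (arc_side j) l w.
  by rewrite (@signed_sideN _ (signs z)) 1?eq_sym //; have := wK l lK; lra.
move: wk; rewrite chordE => -[s sI <-].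
have /andP[s0 s1] : 0 <= s <= 1 by move: sI; rewrite /= in_itv.
rewrite (signed_side_between _ l _ _ s).
by rewrite addr_ge0 // mulr_ge0 ?subr_ge0 // (touches_ge0 l jk) // !inE eqxx ?orbT.
Qed.

(** The isomorphism sends a region to the one arc whose cell it is: existence is [cell_has_arc],
    uniqueness is [arc_side_inj]. *)
Lemma goulden_yong_dual_touches : (0 < n)%N ->
  same_labeled_graph (goulden_yong_dual D G)
    (@LabeledGraph n m 'I_n (fun x i => x = i)
       (fun k x y => [/\ x <> y, touches x k & touches y k])).
Proof.
move=> n0.
have regP i : is_region D G (sign_cell (arc_side i)).
  by have [z /arc_sub_cell] := arc_nonempty i; apply: sign_cell_region.
pose reg i : {A | is_region D G A} := exist _ _ (regP i).
have reg_inj i j : sign_cell (arc_side i) = sign_cell (arc_side j) -> i = j.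
  move=> ij; have [z /arc_sub_cell zi] := arc_nonempty i.
  apply: arc_side_inj => k; apply/eqP/negPn/negP => kij.
  have zj : sign_cell (arc_side j) z by rewrite -ij.
  have := zj.2 k; rewrite (@signed_sideN _ (arc_side i)) 1?eq_sym //.
  by have := zi.2 k; lra.
have lab (A : {A | is_region D G A}) : exists i, sval A = sign_cell (arc_side i).
  case: (svalP A) => z zA ->; have [i /funext iE] := cell_has_arc n0 zA.
  by exists i; rewrite -iE; apply: region_sign_cell; apply: disk_minus_chords_signs.
pose f A := sval (cid (lab A)).
have fE A : sval A = sign_cell (arc_side (f A)) by rewrite /f; case: cid.
exists f; split=> [|A i|k A B].
- exists reg => [A|i]; last by apply: reg_inj; rewrite -fE.
  case: A (fE A) => A AP /= AE; rewrite /reg; move: (regP _); rewrite -AE => AP'.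
  by congr exist; apply: Prop_irrelevance.
(* A cell that contains arc [i] shares a point with the cell of [i], and both are the component of
   that point. *)
- rewrite /= fE; split=> [iA|<-]; last exact: arc_sub_cell.
  have [z zi] := arc_nonempty i; apply: reg_inj.
  by rewrite -(region_sign_cell (iA z zi)) -(region_sign_cell (arc_sub_cell zi)).
- rewrite /= !fE; split=> -[AB kA kB]; split.
  + by move=> fAB; apply: AB; rewrite fAB.
  + exact/chord_boundary_touches.
  + exact/chord_boundary_touches.
  + by move=> /reg_inj.
  + exact/chord_boundary_touches.
  + exact/chord_boundary_touches.
Qed.

End Regions.

Theorem theorem7p5 (R : realType) (n : nat) (n_gt0 : (0 < n)%N)
    (s : (n.-1).-tuple {perm 'I_n}) (hs : descending_factorization s)
    (D : clockwise_points R n) :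
  same_labeled_graph (goulden_yong_dual D (graph_of_seq s))
                     (trail_dual (graph_of_seq s)).
Proof.
have /choice[lo /choice[hi ends]] : forall k, exists a b : 'I_n,
    (a < b)%N /\ tnth s k = tperm a b.
  move=> k; have [x [y [xy skE]]] := hs.1 k.
  case: (ltngtP x y) => [lt|lt|/val_inj E]; first by exists x, y.
    by exists y, x; rewrite tpermC.
  by rewrite E eqxx in xy.
have lo_lt_hi k := (ends k).1; have sE k := (ends k).2.
have chordE k : chord D (graph_of_seq s) k =
    segment (circle_point D (angle D (lo k))) (circle_point D (angle D (hi k))).
  apply/seteqP; split=> [z [x [y [i [j [[xy kE] /= <- <-]]]]]|z zk]; last first.
    exists (lo k), (hi k), (lo k), (hi k); split=> //; split; last exact: sE.
    by move=> E; have := lo_lt_hi k; rewrite E ltnn.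
  have xE : tperm (lo k) (hi k) x = y by rewrite -sE kE tpermL.
  move: xE xy; case: tpermP => [->|->|_ _ ->] // <- _ // [t t01 <-].
  (* Here the chord is traversed from its [hi] end. *)
  exists (1 - t).
    by move: t01; rewrite /= !in_itv /= => /andP[? ?]; apply/andP; split; lra.
  by rewrite /line_path; congr pair; ring.
have := @goulden_yong_dual_touches R n n.-1 D (graph_of_seq s) lo hi lo_lt_hi chordE
  (uses s) _ _ _ _ n_gt0.
case.
- move=> i k l v ik.
  have := uses_end_closed_side hs (lo_lt_hi l) (sE l) (sE k) ik.
  by rewrite /arc_side !inE; case: ifP => _ /andP[? ?] /orP[]/eqP ->.
- by move=> k c; have [u [uk uc]] := uses_on_side hs c (lo_lt_hi k) (sE k); exists u.
- move=> i j ij; apply: (arcs_separated hs) => k a b ab skE.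
  have := ij k; rewrite /arc_side.
  (* Evaluating both forms of factor [k] at [a] shows that its increasing pair of ends is unique. *)
  have := congr1 (fun p : {perm 'I_n} => p a) (etrans (esym skE) (sE k)).
  rewrite tpermL; case: tpermP => [aE bE|aE bE|_ _ E].
  + by rewrite aE bE.
  + by have := lo_lt_hi k; rewrite -aE -bE => /(ltn_trans ab); rewrite ltnn.
  + by move: ab; rewrite E ltnn.
- by move=> k l lE hE; apply: (factors_distinct hs); rewrite !sE lE hE.
move=> f [fbij flab fedge]; exists f; split=> // k x y.
by rewrite fedge /=; split=> -[xy xk yk]; split=> //; apply/trail_usesP => //; exact: hs.1.
Qed.
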